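(* Let $(X,\rho)$ be a complete locally compact $\mathbb R$-tree. Then the metric space $(\mathcal O_+^r(X),\operatorname{Hd})$ is isometric to $(X,\rho)$, and the topological space $\mathcal O_+(X)$ (with the topology generated by the base $\mathcal B$ described below) is homeomorphic to the metric compactification $\overline{X}_m$ of $X$.
   Context: An $\mathbb R$-tree is a geodesic metric space in which any two points are joined by a unique segment and $[xy]\subset[xz]\cup[zy]$ for all $x,y,z$. For a partial order $\tau$ on $X$ (written $x\,\tau\,y$), $(X,\rho,\tau)$ is an upper-semilinear metric $\vee$-semilattice if: any two points $x,y$ have a supremum $x\vee y$; $x\,\tau\, z\,\tau\, y$ implies $\rho(x,z)+\rho(z,y)=\rho(x,y)$; $\rho(x,y)=\rho(x,x\vee y)+\rho(x\vee y,y)$ for all $x,y$; and every upper cone $\{y: x\,\tau\, y\}$ is linearly ordered. $\mathcal O_+(X)$ is the set of all partial orders $\tau$ on $X$ for which this holds; $\mathcal O_+^r(X)\subset\mathcal O_+(X)$ is the subset of rooted orders, i.e. those having a greatest element (the root). For $y\in X$, $\preceq_{(y)}$ denotes the order in $\mathcal O_+(X)$ with root $y$, namely $s\preceq_{(y)} t$ iff $t\in[ys]$. Each order is regarded as a subset of $X\times X$, equipped with the sum metric $d_+((x_1,x_2),(y_1,y_2))=\rho(x_1,y_1)+\rho(x_2,y_2)$, and $\operatorname{Hd}(V,W)=\inf\{\varepsilon>0: V\subset\mathcal N_\varepsilon(W),\ W\subset\mathcal N_\varepsilon(V)\}$ is the Hausdorff distance with respect to $d_+$, where $\mathcal N_\varepsilon$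 is the open $\varepsilon$-neighbourhood. The topology on $\mathcal O_+(X)$ is the one generated by the base $\mathcal B$ consisting of all open subsets of the metric space $(\mathcal O_+^r(X),\operatorname{Hd})$ together with all sets $\mathcal U_{(x,y)}=\{\tau\in\mathcal O_+(X): x\,\tau\, y\}\setminus\{\preceq_{(y)}\}$ for $x\neq y$ in $X$. The metric compactification $\overline{X}_m$ is the closure of the image of $X$ under the embedding $x\mapsto d_x$, $d_x(y)=\rho(x,y)-\rho(o,x)$ ($o\in X$ a fixed point), into the quotient $C(X,\mathbb R)/\{\text{constants}\}$, where $C(X,\mathbb R)$ carries the compact-open topology. *)

(* Defs.v *)
From Stdlib Require Import Reals List.
Open Scope R_scope.
Set Implicit Arguments.

Definition is_metric {X : Type} (rho : X -> X -> R) : Prop :=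
  (forall x y, 0 <= rho x y) /\
  (forall x y, rho x y = 0 <-> x = y) /\
  (forall x y, rho x y = rho y x) /\
  (forall x y z, rho x z <= rho x y + rho y z).

Definition metric_open {X : Type} (rho : X -> X -> R) (U : X -> Prop) : Prop :=
  forall x, U x -> exists e, 0 < e /\ forall y, rho x y < e -> U y.

Definition compact_for {T : Type} (opn : (T -> Prop) -> Prop) (K : T -> Prop) : Prop :=
  forall (I : Type) (F : I -> T -> Prop),
    (forall i, opn (F i)) ->
    (forall x, K x -> exists i, F i x) ->
    exists l : list I, forall x, K x -> exists i, In i l /\ F i x.

Definition complete {X : Type} (rho : X -> X -> R) : Prop :=
  forall u : nat -> X,
    (forall e, 0 < e -> exists N, forall m n, (N <= m)%nat -> (N <= n)%nat -> rho (u m) (u n) < e) ->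
    exists l, forall e, 0 < e -> exists N, forall n, (N <= n)%nat -> rho (u n) l < e.

Definition locally_compact {X : Type} (rho : X -> X -> R) : Prop :=
  forall x, exists K, compact_for (metric_open rho) K /\
    exists e, 0 < e /\ forall y, rho x y < e -> K y.

Definition is_geodesic {X : Type} (rho : X -> X -> R) (x y : X) (g : R -> X) : Prop :=
  g 0 = x /\ g (rho x y) = y /\
  forall s t, 0 <= s <= rho x y -> 0 <= t <= rho x y -> rho (g s) (g t) = Rabs (s - t).

Definition segment {X : Type} (rho : X -> X -> R) (x y : X) : X -> Prop :=
  fun z => exists g, is_geodesic rho x y g /\ exists t, 0 <= t <= rho x y /\ g t = z.

Definition is_R_tree {X : Type} (rho : X -> X -> R) : Prop :=
  is_metric rho /\
  (forall x y, exists g, is_geodesic rho x y g) /\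
  (forall x y g1 g2, is_geodesic rho x y g1 -> is_geodesic rho x y g2 ->
     forall t, 0 <= t <= rho x y -> exists s, 0 <= s <= rho x y /\ g2 s = g1 t) /\
  (forall x y z w, segment rho x y w -> segment rho x z w \/ segment rho z y w).

Definition rel (X : Type) := X -> X -> Prop.

Definition is_partial_order {X : Type} (tau : rel X) : Prop :=
  (forall x, tau x x) /\
  (forall x y, tau x y -> tau y x -> x = y) /\
  (forall x y z, tau x y -> tau y z -> tau x z).

Definition is_sup {X : Type} (tau : rel X) (x y s : X) : Prop :=
  tau x s /\ tau y s /\ forall u, tau x u -> tau y u -> tau s u.

Definition usms {X : Type} (rho : X -> X -> R) (tau : rel X) : Prop :=
  is_partial_order tau /\
  (forall x y, exists s, is_sup tau x y s) /\
  (forall x z y, tau x z -> tau z y -> rho x z + rho z y = rho x y) /\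
  (forall x y s, is_sup tau x y s -> rho x y = rho x s + rho s y) /\
  (forall x y z, tau x y -> tau x z -> tau y z \/ tau z y).

Definition O_plus {X : Type} (rho : X -> X -> R) : rel X -> Prop := fun tau => usms rho tau.

Definition O_plus_r {X : Type} (rho : X -> X -> R) : rel X -> Prop :=
  fun tau => usms rho tau /\ exists r, forall x, tau x r.

Definition preceq_root {X : Type} (rho : X -> X -> R) (y : X) : rel X :=
  fun s t => segment rho y s t.

Definition d_plus {X : Type} (rho : X -> X -> R) (p q : X * X) : R :=
  rho (fst p) (fst q) + rho (snd p) (snd q).

Definition nbhd {X : Type} (rho : X -> X -> R) (eps : R) (W : X * X -> Prop) : X * X -> Prop :=
  fun p => exists q, W q /\ d_plus rho p q < eps.

Definition as_set {X : Type} (tau : rel X) : X * X -> Prop := fun p => tau (fst p) (snd p).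

Definition Hd_admissible {X : Type} (rho : X -> X -> R) (V W : X * X -> Prop) (eps : R) : Prop :=
  0 < eps /\ (forall p, V p -> nbhd rho eps W p) /\ (forall p, W p -> nbhd rho eps V p).

Definition is_Hd {X : Type} (rho : X -> X -> R) (V W : X * X -> Prop) (d : R) : Prop :=
  (forall e, Hd_admissible rho V W e -> d <= e) /\
  (forall b, (forall e, Hd_admissible rho V W e -> b <= e) -> b <= d).

Definition Hd_lt {X : Type} (rho : X -> X -> R) (V W : X * X -> Prop) (eps : R) : Prop :=
  exists e, e < eps /\ Hd_admissible rho V W e.

Definition rooted_orders_isometric {X : Type} (rho : X -> X -> R) : Prop :=
  exists f : X -> rel X,
    (forall x, O_plus_r rho (f x)) /\
    (forall tau, O_plus_r rho tau -> exists x, f x = tau) /\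
    (forall x y, is_Hd rho (as_set (f x)) (as_set (f y)) (rho x y)).

Definition Hd_open {X : Type} (rho : X -> X -> R) (U : rel X -> Prop) : Prop :=
  (forall tau, U tau -> O_plus_r rho tau) /\
  (forall tau, U tau -> exists eps, 0 < eps /\
     forall sigma, O_plus_r rho sigma -> Hd_lt rho (as_set tau) (as_set sigma) eps -> U sigma).

Definition U_xy {X : Type} (rho : X -> X -> R) (x y : X) : rel X -> Prop :=
  fun tau => O_plus rho tau /\ tau x y /\ tau <> preceq_root rho y.

Definition in_base {X : Type} (rho : X -> X -> R) (B : rel X -> Prop) : Prop :=
  Hd_open rho B \/ exists x y, x <> y /\ B = U_xy rho x y.

Definition O_plus_open {X : Type} (rho : X -> X -> R) (U : rel X -> Prop) : Prop :=
  (forall tau, U tau -> O_plus rho tau) /\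
  (forall tau, U tau -> exists B, in_base rho B /\ B tau /\ forall s, B s -> U s).

Definition continuous_fun {X : Type} (rho : X -> X -> R) (f : X -> R) : Prop :=
  forall x e, 0 < e -> exists d, 0 < d /\ forall y, rho x y < d -> Rabs (f y - f x) < e.

Definition R_open (U : R -> Prop) : Prop :=
  forall r, U r -> exists e, 0 < e /\ forall s, Rabs (s - r) < e -> U s.

Definition co_subbasic {X : Type} (K : X -> Prop) (U : R -> Prop) (f : X -> R) : Prop :=
  forall x, K x -> U (f x).

Definition co_open {X : Type} (rho : X -> X -> R) (W : (X -> R) -> Prop) : Prop :=
  (forall f, W f -> continuous_fun rho f) /\
  (forall f, W f -> exists l : list ((X -> Prop) * (R -> Prop)),
     (forall KU, In KU l -> compact_for (metric_open rho) (fst KU) /\ R_open (snd KU)) /\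
     (forall KU, In KU l -> co_subbasic (fst KU) (snd KU) f) /\
     (forall g, continuous_fun rho g ->
        (forall KU, In KU l -> co_subbasic (fst KU) (snd KU) g) -> W g)).

Definition mod_const {X : Type} (f : X -> R) : (X -> R) -> Prop :=
  fun g => exists c, forall x, g x = f x + c.

Definition Cquot {X : Type} (rho : X -> X -> R) : ((X -> R) -> Prop) -> Prop :=
  fun q => exists f, continuous_fun rho f /\ q = mod_const f.

Definition Cquot_open {X : Type} (rho : X -> X -> R) (UU : ((X -> R) -> Prop) -> Prop) : Prop :=
  (forall q, UU q -> Cquot rho q) /\
  co_open rho (fun f => continuous_fun rho f /\ UU (mod_const f)).

Definition d_emb {X : Type} (rho : X -> X -> R) (o x : X) : (X -> R) -> Prop :=
  mod_const (fun y => rho x y - rho o x).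

Definition metric_compactification {X : Type} (rho : X -> X -> R) (o : X)
  : ((X -> R) -> Prop) -> Prop :=
  fun q => Cquot rho q /\
    forall UU, Cquot_open rho UU -> UU q -> exists x, UU (d_emb rho o x).

Definition mc_open {X : Type} (rho : X -> X -> R) (o : X)
  (WW : ((X -> R) -> Prop) -> Prop) : Prop :=
  exists UU, Cquot_open rho UU /\
    forall q, WW q <-> (metric_compactification rho o q /\ UU q).

(* OA (resp. OB) is the collection of open subsets of A (resp. B) *)
Definition homeomorphic {T1 T2 : Type} (A : T1 -> Prop) (OA : (T1 -> Prop) -> Prop)
  (B : T2 -> Prop) (OB : (T2 -> Prop) -> Prop) : Prop :=
  exists f : T1 -> T2,
    (forall a, A a -> B (f a)) /\
    (forall a a', A a -> A a' -> f a = f a' -> a = a') /\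
    (forall b, B b -> exists a, A a /\ f a = b) /\
    (forall U, (forall a, U a -> A a) ->
       (OA U <-> OB (fun b => exists a, U a /\ f a = b))).

(* Main.v *)
Require Import Defs.
From Stdlib Require Import Reals Lra Lia List Classical ClassicalEpsilon
  FunctionalExtensionality PropExtensionality.

(** Both spaces are parametrised by the functions [h] such that every segment [[x, y]]
    contains a point [m] at which [h] has decreased at unit speed from both ends,
    taken up to constants.  Such an [h] defines the order [h x - h y = rho x y], in which
    [m] is the supremum of [x] and [y]; conversely an order gives back
    [h x - h y = rho x s - rho y s] with [s] the supremum.  The condition on [h] holds for
    distance functions and passes to pointwise limits, so it holds on the metric
    compactification.  By completeness an [h] without a minimum decreases at unit speed
    forever, and on a compact set it agrees up to a constant with the distance to a far
    point of such a ray, so it lies in the closure.  For the topologies: if [y] lies below [y'],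
    then [h] is determined up to a constant at all points separated from [y'] by [y], while
    local compactness gives compact spheres around [z], and [h] has a root inside such a
    sphere as soon as it is larger there than at [z]. *)

(** * Extensionality and bounds over finite lists *)

Lemma pred_ext (T : Type) (P Q : T -> Prop) : (forall x, P x <-> Q x) -> P = Q.
Proof.
  intros H; apply functional_extensionality; intros x.
  apply propositional_extensionality, H.
Qed.

Lemma rel_ext (T : Type) (P Q : rel T) : (forall x y, P x y <-> Q x y) -> P = Q.
Proof.
  intros H; apply functional_extensionality; intros x.
  apply pred_ext, H.
Qed.

Lemma list_bound (T : Type) (P : T -> R -> Prop) (l : list T) :
  (forall a b c, P a b -> b <= c -> P a c) ->
  (forall a, In a l -> exists b, P a b) ->
  exists b, 0 <= b /\ forall a, In a l -> P a b.
Proof.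
  intros Hmon; induction l as [|a l IH]; intros H.
  - exists 0; split; [lra | intros a []].
  - destruct IH as [b [Hb0 Hb]]; [intros; apply H; right; assumption |].
    destruct (H a (or_introl eq_refl)) as [c Hc].
    exists (Rmax b c); split.
    + pose proof (Rmax_l b c); lra.
    + intros a' [<-|Ha].
      * apply (Hmon _ _ _ Hc), Rmax_r.
      * apply (Hmon _ _ _ (Hb a' Ha)), Rmax_l.
Qed.

Lemma list_small (T : Type) (P : T -> R -> Prop) (l : list T) :
  (forall a b c, P a b -> c <= b -> P a c) ->
  (forall a, In a l -> exists b, 0 < b /\ P a b) ->
  exists b, 0 < b /\ forall a, In a l -> P a b.
Proof.
  intros Hmon; induction l as [|a l IH]; intros H.
  - exists 1; split; [lra | intros a []].
  - destruct IH as [b [Hb0 Hb]]; [intros; apply H; right; assumption |].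
    destruct (H a (or_introl eq_refl)) as [c [Hc0 Hc]].
    exists (Rmin b c); split.
    + apply Rmin_glb_lt; assumption.
    + intros a' [<-|Ha].
      * apply (Hmon _ _ _ Hc), Rmin_r.
      * apply (Hmon _ _ _ (Hb a' Ha)), Rmin_l.
Qed.

(** Membership of [z] in the segment from [x] to [y], written as a linear equation between
    distances; in the tree, [segment_between] and [between_segment] give the equivalence. *)
Definition between {X : Type} (rho : X -> X -> R) (x z y : X) : Prop :=
  rho x z + rho z y = rho x y.

(* The functions [fun x => rho z x] and the Busemann functions of the tree,
   up to constants. *)
Definition horofunction {X : Type} (rho : X -> X -> R) (h : X -> R) : Prop :=
  forall x y, exists m, between rho x m y /\
    h x - h m = rho x m /\ h y - h m = rho y m.

Definition order_of {X : Type} (rho : X -> X -> R) (h : X -> R) : rel X :=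
  fun x y => h x - h y = rho x y.

(** For the order of a horofunction this is its class modulo constants, read off from the order
    without choosing a representative. It is the map of the homeomorphism. *)
Definition potentials {X : Type} (rho : X -> X -> R) (tau : rel X) : (X -> R) -> Prop :=
  fun g => forall x y, tau x y -> g x - g y = rho x y.

(** * Metric facts and the orders defined by horofunctions *)

Section RTree.

Context {X : Type} (rho : X -> X -> R) (Hmet : is_metric rho).

Lemma dist_ge0 x y : 0 <= rho x y.
Proof. apply Hmet. Qed.

Lemma dist_sym x y : rho x y = rho y x.
Proof. apply Hmet. Qed.

Lemma dist_tri x y z : rho x z <= rho x y + rho y z.
Proof. apply Hmet. Qed.

Lemma dist_eq x y : rho x y = 0 -> x = y.
Proof. apply Hmet. Qed.

Lemma dist_refl x : rho x x = 0.
Proof. apply Hmet; reflexivity. Qed.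

Lemma dist_pos x y : x <> y -> 0 < rho x y.
Proof.
  intros H; destruct (dist_ge0 x y) as [H0|H0]; [assumption|].
  contradiction H; apply dist_eq; auto.
Qed.

Lemma segment_between x y z : segment rho x y z -> between rho x z y.
Proof.
  intros [g [[H0 [H1 H]] [t [Ht <-]]]]; unfold between.
  pose proof (H 0 t ltac:(lra) Ht) as E0; pose proof (H t (rho x y) Ht ltac:(lra)) as E1.
  rewrite H0, Rabs_left1 in E0 by lra; rewrite H1, Rabs_left1 in E1 by lra; lra.
Qed.

Lemma horofunction_lip h : horofunction rho h -> forall x y, h x - h y <= rho x y.
Proof.
  intros Hh x y; destruct (Hh x y) as [m [Hm [H1 H2]]]; unfold between in Hm.
  rewrite (dist_sym m y) in Hm; pose proof (dist_ge0 y m); lra.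
Qed.

Lemma horofunction_continuous h : horofunction rho h -> continuous_fun rho h.
Proof.
  intros Hh x e He; exists e; split; [assumption|]; intros y Hy.
  pose proof (horofunction_lip _ Hh x y); pose proof (horofunction_lip _ Hh y x).
  rewrite (dist_sym y x) in *; apply Rabs_def1; lra.
Qed.

Lemma order_of_refl h x : order_of rho h x x.
Proof. unfold order_of; rewrite dist_refl; lra. Qed.

Lemma order_of_antisym h x y : order_of rho h x y -> order_of rho h y x -> x = y.
Proof.
  unfold order_of; intros H1 H2; apply dist_eq; rewrite (dist_sym y x) in H2; lra.
Qed.

Lemma order_of_between h x y z : horofunction rho h ->
  order_of rho h x y -> order_of rho h y z -> between rho x y z.
Proof.
  unfold order_of, between; intros Hh H1 H2.
  pose proof (horofunction_lip _ Hh x z); pose proof (dist_tri x y z); lra.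
Qed.

Lemma order_of_trans h x y z : horofunction rho h ->
  order_of rho h x y -> order_of rho h y z -> order_of rho h x z.
Proof.
  intros Hh H1 H2; pose proof (order_of_between _ _ _ _ Hh H1 H2).
  unfold order_of, between in *; lra.
Qed.

Lemma order_of_interval h x y z : horofunction rho h ->
  between rho x y z -> order_of rho h x z -> order_of rho h x y /\ order_of rho h y z.
Proof.
  unfold order_of, between; intros Hh H1 H2.
  pose proof (horofunction_lip _ Hh x y); pose proof (horofunction_lip _ Hh y z).
  split; lra.
Qed.

Lemma mod_const_eq (f g : X -> R) c : (forall x, g x = f x + c) -> mod_const f = mod_const g.
Proof.
  intros H; apply pred_ext; intros k; split; intros [d Hd].
  - exists (d - c); intros x; rewrite Hd, H; lra.
  - exists (d + c); intros x; rewrite Hd, H; lra.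
Qed.

Lemma mod_const_inv (f g : X -> R) : mod_const f = mod_const g ->
  exists c, forall x, g x = f x + c.
Proof.
  intros H; change (mod_const f g); rewrite H; exists 0; intros x; lra.
Qed.

(** Any [x] has a common upper bound [m] with [o]. Both [g] and [h] drop at unit speed from [x] and
    from [o] to [m], so [g - h] takes the same value at [x] and [o]. *)
Lemma potentials_order_of (o : X) h : horofunction rho h ->
  potentials rho (order_of rho h) = mod_const h.
Proof.
  intros Hh; apply pred_ext; intros g; split.
  - intros Hg; exists (g o - h o); intros x.
    destruct (Hh x o) as [m [_ [H1 H2]]].
    pose proof (Hg _ _ H1); pose proof (Hg _ _ H2); lra.
  - intros [c Hc] x y Hxy; rewrite !Hc; unfold order_of in Hxy; lra.
Qed.

Lemma order_of_mod_const h h' : mod_const h = mod_const h' ->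
  order_of rho h = order_of rho h'.
Proof.
  intros H; destruct (mod_const_inv _ _ H) as [c Hc].
  apply rel_ext; intros x y; unfold order_of; rewrite !Hc; split; lra.
Qed.

(** Take [h x = rho x s - rho o s] with [s] the supremum of [x] and [o]; the supremum of two points
    is then the required point of their segment. *)
Lemma usms_horofunction (o : X) tau : usms rho tau ->
  exists h, horofunction rho h /\ tau = order_of rho h.
Proof.
  intros [[Hr [Ha Ht]] [Hs [Hb [Hd Hl]]]].
  pose (sup x := proj1_sig (constructive_indefinite_description _ (Hs x o))).
  assert (Hsup : forall x, is_sup tau x o (sup x)).
  { intros x; apply (proj2_sig (constructive_indefinite_description _ (Hs x o))). }
  pose (h x := rho x (sup x) - rho o (sup x)).
  assert (Hpot : forall x y, tau x y -> h x - h y = rho x y).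
  { intros x y Hxy; unfold h.
    destruct (Hsup x) as [Hx1 [Hx2 Hx3]], (Hsup y) as [Hy1 [Hy2 Hy3]].
    (* The upper cone of [x] is a chain. If [y] is below [sup x], then [y] and [x] have the same
       supremum with [o]; otherwise [y] is itself above [o]. *)
    destruct (Hl _ _ _ Hxy Hx1) as [H|H].
    - assert (E : sup y = sup x).
      { apply Ha; auto. apply Hx3; auto. apply Ht with y; auto. }
      rewrite E; pose proof (Hb _ _ _ Hxy H); lra.
    - assert (E : sup y = y).
      { apply Ha; auto. apply Hy3; auto. apply Ht with (sup x); auto. }
      rewrite E, dist_refl.
      pose proof (Hb _ _ _ Hx1 H); pose proof (Hb _ _ _ Hx2 H); lra. }
  exists h; split.
  - intros x y; destruct (Hs x y) as [s Hxy]; exists s.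
    pose proof (Hd _ _ _ Hxy); destruct Hxy as [H1 [H2 _]].
    split; [unfold between; lra | auto].
  - apply rel_ext; intros x y; split; [apply Hpot|]; intros Hxy.
    destruct (Hs x y) as [s H]; pose proof (Hd _ _ _ H); destruct H as [H1 [H2 _]].
    pose proof (Hpot _ _ H1); pose proof (Hpot _ _ H2); unfold order_of in Hxy.
    rewrite (dist_sym s y) in *; pose proof (dist_ge0 y s).
    (* A drop of the full [rho x y] from [x] to [y] leaves no distance between [y] and [s]. *)
    assert (E : y = s) by (apply dist_eq; lra).
    rewrite E; assumption.
Qed.

(** * Compact sets and the quotient of the compact-open topology *)

Lemma compact_bounded (o : X) K : compact_for (metric_open rho) K ->
  exists D, forall y, K y -> rho o y <= D.
Proof.
  intros HK; destruct (HK R (fun D y => rho o y < D)) as [l Hl].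
  - intros D x Hx; exists (D - rho o x); split; [lra|]; intros y Hy.
    pose proof (dist_tri o x y); lra.
  - intros y _; exists (rho o y + 1); lra.
  - destruct (list_bound _ (fun a b => a <= b) l) as [D [_ HD]].
    + intros; lra.
    + intros a _; exists a; lra.
    + exists D; intros y Hy; destruct (Hl y Hy) as [i [Hi Hy']].
      pose proof (HD _ Hi); simpl in *; lra.
Qed.

Lemma compact_single (p : X) : compact_for (metric_open rho) (fun y => y = p).
Proof.
  intros I F _ H; destruct (H p eq_refl) as [i Hi].
  exists (i :: nil); intros x ->; exists i; split; [left; reflexivity | assumption].
Qed.

(** A cover of the sphere becomes a cover of [K] once the open complement of the sphere is added, as
    the index [None]. *)
Lemma compact_sphere (K : X -> Prop) z r : compact_for (metric_open rho) K ->
  (forall y, rho z y = r -> K y) -> compact_for (metric_open rho) (fun y => rho z y = r).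
Proof.
  intros HK Hsub I F HF Hcov.
  destruct (HK (option I) (fun i y => match i with Some i => F i y | None => rho z y <> r end))
    as [l Hl].
  - intros [i|]; [apply HF|]; intros x Hx.
    exists (Rabs (rho z x - r)); split; [apply Rabs_pos_lt; lra|].
    intros y Hy E; rewrite <- E in Hy.
    pose proof (dist_tri z x y); pose proof (dist_tri z y x); rewrite (dist_sym y x) in *.
    assert (Rabs (rho z x - rho z y) <= rho x y) by (apply Rabs_le; lra); lra.
  - intros x Hx; destruct (classic (rho z x = r)) as [E|E].
    + destruct (Hcov x E) as [i Hi]; exists (Some i); assumption.
    + exists None; assumption.
  - exists (flat_map (fun i => match i with Some i => i :: nil | None => nil end) l).
    intros x Hx; destruct (Hl x (Hsub x Hx)) as [[i|] [Hi Hi']]; [|contradiction].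
    exists i; split; [|assumption].
    apply in_flat_map; exists (Some i); split; [assumption | left; reflexivity].
Qed.

Lemma compact_margin K U f : compact_for (metric_open rho) K -> R_open U ->
  continuous_fun rho f -> co_subbasic K U f ->
  exists e, 0 < e /\ forall g, (forall y, Rabs (g y - f y) < e) -> co_subbasic K U g.
Proof.
  intros HK HU Hf HKU.
  (* The strict inequality [e < e'] leaves room to move the centre [f y], so each member of the
     cover is open. *)
  destruct (HK R (fun e y => 0 < e /\ exists e', e < e' /\
                    forall r, Rabs (r - f y) < e' -> U r)) as [l Hl].
  - intros e x [He [e' [He' H]]].
    destruct (Hf x ((e' - e) / 2)) as [d [Hd Hd']]; [lra|].
    exists d; split; [assumption|]; intros y Hy; split; [assumption|].
    exists ((e + e') / 2); split; [lra|]; intros r Hr; apply H.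
    pose proof (Hd' y Hy).
    replace (r - f x) with ((r - f y) + (f y - f x)) by ring.
    pose proof (Rabs_triang (r - f y) (f y - f x)); lra.
  - intros x Hx; destruct (HU _ (HKU x Hx)) as [e [He H]].
    exists (e / 2); split; [lra|]; exists e; split; [lra|assumption].
  - destruct (list_small _ (fun a b => 0 < a -> b <= a) l) as [e [He He']].
    + intros a b c H Hc Ha; specialize (H Ha); lra.
    + intros a _; destruct (Rlt_dec 0 a) as [Ha|Ha].
      * exists a; split; [assumption | intros; lra].
      * exists 1; split; [lra | intros; lra].
    + exists e; split; [assumption|]; intros g Hg x Hx.
      destruct (Hl x Hx) as [i [Hi [Hi0 [e' [Hie HU']]]]].
      apply HU'; pose proof (He' i Hi Hi0); pose proof (Hg x); lra.
Qed.

Lemma continuous_shift f g c : continuous_fun rho f -> (forall x, g x = f x + c) ->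
  continuous_fun rho g.
Proof.
  intros Hf H x e He; destruct (Hf x e He) as [d [Hd Hd']].
  exists d; split; [assumption|]; intros y Hy; rewrite !H.
  replace (f y + c - (f x + c)) with (f y - f x) by ring; auto.
Qed.

Definition basic_open (l : list ((X -> Prop) * (R -> Prop))) : ((X -> R) -> Prop) -> Prop :=
  fun q => exists g, continuous_fun rho g /\ q = mod_const g /\
    forall KU, In KU l -> co_subbasic (fst KU) (snd KU) g.

(** Two representatives of a class differ by a constant [c]; translating each open set of reals by
    [c] transfers the constraints from one to the other. *)
Lemma basic_open_open l :
  (forall KU, In KU l -> compact_for (metric_open rho) (fst KU) /\ R_open (snd KU)) ->
  Cquot_open rho (basic_open l).
Proof.
  intros Hl; split.
  - intros q [g [Hg [Hq _]]]; exists g; auto.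
  - split; [intros f [Hf _]; assumption|].
    intros f [Hf [g [Hg [Hfg Hgl]]]].
    destruct (mod_const_inv _ _ Hfg) as [c Hc].
    exists (map (fun KU => (fst KU, fun r => snd KU (r + c))) l).
    split; [|split].
    + intros KU HKU; apply in_map_iff in HKU; destruct HKU as [KU' [<- HKU]].
      destruct (Hl _ HKU) as [HK HU]; split; [assumption|]; simpl.
      intros r Hr; destruct (HU _ Hr) as [e [He H]]; exists e; split; [assumption|].
      intros s Hs; apply H; replace (s + c - (r + c)) with (s - r) by ring; assumption.
    + intros KU HKU; apply in_map_iff in HKU; destruct HKU as [KU' [<- HKU]].
      intros x Hx; simpl; rewrite <- Hc; apply (Hgl _ HKU); assumption.
    + intros k Hk Hkl; split; [assumption|].
      exists (fun x => k x + c); split; [|split].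
      * apply (continuous_shift k _ c); auto.
      * apply mod_const_eq with c; auto.
      * intros KU HKU x Hx.
        apply (Hkl (fst KU, fun r => snd KU (r + c))); [|assumption].
        apply in_map_iff; exists KU; auto.
Qed.

Lemma Cquot_open_union (P : (((X -> R) -> Prop) -> Prop) -> Prop) :
  (forall V, P V -> Cquot_open rho V) ->
  Cquot_open rho (fun q => exists V, P V /\ V q).
Proof.
  intros HP; split.
  - intros q [V [HV Hq]]; apply (HP V HV); assumption.
  - split; [intros f [Hf _]; assumption|].
    intros f [Hf [V [HV HVf]]].
    destruct (proj2 (HP V HV)) as [_ H]; destruct (H f (conj Hf HVf)) as [l [H1 [H2 H3]]].
    exists l; split; [assumption|split; [assumption|]].
    intros g Hg Hgl; split; [assumption|]; exists V; split; [assumption|].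
    apply H3; assumption.
Qed.

(** * Segments and medians in the tree *)

Context (Hgeo : forall x y, exists g, is_geodesic rho x y g).
Context (Huniq : forall x y g1 g2, is_geodesic rho x y g1 -> is_geodesic rho x y g2 ->
  forall t, 0 <= t <= rho x y -> exists s, 0 <= s <= rho x y /\ g2 s = g1 t).
Context (Htriangle : forall x y z w,
  segment rho x y w -> segment rho x z w \/ segment rho z y w).

(** Geodesics from [x] to [z] and from [z] to [y] concatenate to a geodesic, because their lengths
    add up to [rho x y]. *)
Lemma between_segment x y z : between rho x z y -> segment rho x y z.
Proof.
  unfold between; intros Hz.
  destruct (Hgeo x z) as [g1 [A0 [A1 A]]], (Hgeo z y) as [g2 [B0 [B1 B]]].
  pose proof (dist_ge0 x z); pose proof (dist_ge0 z y).
  set (g := fun t => if Rle_dec t (rho x z) then g1 t else g2 (t - rho x z)).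
  assert (G1 : forall t, t <= rho x z -> g t = g1 t).
  { intros t Ht; unfold g; destruct (Rle_dec t (rho x z)); [reflexivity | lra]. }
  assert (G2 : forall t, rho x z <= t -> g t = g2 (t - rho x z)).
  { intros t Ht; unfold g; destruct (Rle_dec t (rho x z)); [|reflexivity].
    replace t with (rho x z) by lra; rewrite A1, Rminus_diag, B0; reflexivity. }
  assert (Gx : g 0 = x) by (rewrite G1 by lra; assumption).
  assert (Gy : g (rho x y) = y).
  { rewrite G2 by lra; replace (rho x y - rho x z) with (rho z y) by lra; assumption. }
  assert (Gxd : forall t, 0 <= t <= rho x z -> rho x (g t) = t /\ rho (g t) z = rho x z - t).
  { intros t Ht; rewrite G1 by lra.
    pose proof (A 0 t ltac:(lra) Ht) as E; rewrite A0, Rabs_left1 in E by lra.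
    pose proof (A t (rho x z) Ht ltac:(lra)) as E'; rewrite A1, Rabs_left1 in E' by lra.
    lra. }
  assert (Gyd : forall t, rho x z <= t <= rho x y ->
                 rho z (g t) = t - rho x z /\ rho (g t) y = rho x y - t).
  { intros t Ht; rewrite G2 by lra.
    pose proof (B 0 (t - rho x z) ltac:(lra) ltac:(lra)) as E.
    rewrite B0, Rabs_left1 in E by lra.
    pose proof (B (t - rho x z) (rho z y) ltac:(lra) ltac:(lra)) as E'.
    rewrite B1, Rabs_left1 in E' by lra.
    lra. }
  (* Strict triangle inequality across [z] would make the path from [x] to [y] shorter than
     [rho x y]. *)
  assert (Gc : forall s t, 0 <= s <= rho x z -> rho x z <= t <= rho x y ->
                 rho (g s) (g t) = t - s).
  { intros s t Hs Ht; destruct (Gxd s Hs), (Gyd t Ht).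
    pose proof (dist_tri (g s) z (g t)); pose proof (dist_tri x (g s) y).
    pose proof (dist_tri (g s) (g t) y); lra. }
  exists g; split.
  - split; [assumption | split; [assumption|]]; intros s t Hs Ht.
    destruct (Rle_dec s (rho x z)), (Rle_dec t (rho x z)).
    + rewrite !G1 by lra; apply A; lra.
    + rewrite Gc by lra; rewrite Rabs_left1; lra.
    + rewrite dist_sym, Gc by lra; rewrite Rabs_pos_eq; lra.
    + rewrite !G2 by lra; rewrite B by lra; f_equal; lra.
  - exists (rho x z); split; [lra|]; rewrite G1 by lra; assumption.
Qed.

(** Uniqueness of the segment puts [z] on the given [g], and its parameter can only be its distance
    from [x]. *)
Lemma geodesic_between x y z g : is_geodesic rho x y g -> between rho x z y ->
  0 <= rho x z <= rho x y /\ g (rho x z) = z.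
Proof.
  intros Hg Hz; pose proof (between_segment _ _ _ Hz) as [g' [Hg' [t [Ht Hgt]]]].
  destruct (Huniq _ _ _ _ Hg' Hg t Ht) as [s [Hs Hst]].
  rewrite Hgt in Hst.
  pose proof (dist_ge0 x z); pose proof (dist_ge0 z y); unfold between in Hz.
  split; [lra|].
  destruct Hg as [G0 [_ G]].
  pose proof (G 0 s ltac:(lra) Hs) as E; rewrite G0, Hst, Rabs_left1 in E by lra.
  rewrite E; replace (- (0 - s)) with s by ring; assumption.
Qed.

Lemma between_dist x y z w : between rho x z y -> between rho x w y ->
  rho z w = Rabs (rho x z - rho x w).
Proof.
  intros Hz Hw; destruct (Hgeo x y) as [g Hg].
  destruct (geodesic_between _ _ _ _ Hg Hz) as [Iz Ez].
  destruct (geodesic_between _ _ _ _ Hg Hw) as [Iw Ew].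
  rewrite <- (proj2 (proj2 Hg)) by assumption; rewrite Ez, Ew; reflexivity.
Qed.

Lemma between_le x y z w : between rho x z y -> between rho x w y ->
  rho x z <= rho x w -> between rho x z w.
Proof.
  intros Hz Hw Hle; unfold between.
  rewrite (between_dist _ _ _ _ Hz Hw), Rabs_left1 by lra; lra.
Qed.

Lemma between_exists x y t : 0 <= t <= rho x y ->
  exists z, between rho x z y /\ rho x z = t.
Proof.
  intros Ht; destruct (Hgeo x y) as [g Hg]; exists (g t); split.
  - apply segment_between; exists g; split; [assumption|]; exists t; auto.
  - destruct Hg as [H0 [_ H]]; pose proof (H 0 t ltac:(lra) Ht) as E.
    rewrite H0, Rabs_left1 in E by lra; lra.
Qed.

Lemma between_or x y z w : between rho x w y -> between rho x w z \/ between rho z w y.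
Proof.
  intros H; destruct (Htriangle _ _ z _ (between_segment _ _ _ H)) as [S|S];
    apply segment_between in S; auto.
Qed.

Lemma median x y z : exists m, between rho x m y /\ between rho x m z /\ between rho y m z.
Proof.
  (* The distance from [x] is the Gromov product of [y] and [z] at [x]. *)
  destruct (between_exists x y ((rho x y + rho x z - rho y z) / 2)) as [m [Hm Em]].
  - pose proof (dist_tri y x z); pose proof (dist_tri x y z); pose proof (dist_tri x z y).
    rewrite (dist_sym y x), (dist_sym z y) in *; lra.
  - exists m; split; [assumption|].
    unfold between in *; pose proof (dist_sym m y); pose proof (dist_sym z y).
    pose proof (dist_sym m z).
    (* Thinness puts [m] on one of the other two sides; by the choice of its distance it then lies
       on both. *)
    destruct (between_or _ _ z _ Hm) as [H'|H']; unfold between in H'; split; lra.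
Qed.

(** * Horofunctions on the tree give semilattice orders *)

Lemma dist_horofunction z : horofunction rho (rho z).
Proof.
  intros x y; destruct (median x y z) as [m [H1 [H2 H3]]]; exists m.
  split; [assumption|]; unfold between in *.
  rewrite (dist_sym z x), (dist_sym z y), (dist_sym z m); lra.
Qed.

Lemma order_of_dist z : order_of rho (rho z) = preceq_root rho z.
Proof.
  apply rel_ext; intros x y; unfold order_of, preceq_root; split; intros H.
  - apply between_segment; unfold between; rewrite (dist_sym y x); lra.
  - apply segment_between in H; unfold between in H; rewrite (dist_sym x y); lra.
Qed.

(** A common upper bound [m] of [y] and [z] places both on the segment from [x] to [m], where
    distance from [x] decides their order. *)
Lemma horofunction_upper_cone h x y z : horofunction rho h ->
  order_of rho h x y -> order_of rho h x z -> rho x y <= rho x z -> order_of rho h y z.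
Proof.
  intros Hh Hy Hz Hle; destruct (Hh y z) as [m [_ [Hym Hzm]]].
  pose proof (order_of_between _ _ _ _ Hh Hy Hym) as By.
  pose proof (order_of_between _ _ _ _ Hh Hz Hzm) as Bz.
  pose proof (between_le _ _ _ _ By Bz Hle) as B.
  unfold order_of, between in *; lra.
Qed.

Lemma horofunction_usms h : horofunction rho h -> usms rho (order_of rho h).
Proof.
  intros Hh; split; [split; [|split]|split; [|split; [|split]]].
  - apply order_of_refl.
  - apply order_of_antisym.
  - intros x y z; apply order_of_trans; assumption.
  - intros x y; destruct (Hh x y) as [m [Hm [Hx Hy]]]; exists m.
    split; [assumption | split; [assumption|]]; intros u Hxu Hyu.
    unfold order_of in *.
    (* By thinness [m] lies on the segment from [x] or from [y] to [u]. Along it [h] decreases at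
       unit speed, hence also from [m] to [u]. *)
    destruct (between_or _ _ u _ Hm) as [B|B]; unfold between in *.
    + lra.
    + pose proof (dist_sym u m); pose proof (dist_sym m y); pose proof (dist_sym u y); lra.
  - intros x z y Hxz Hzy; apply (order_of_between _ _ _ _ Hh Hxz Hzy).
  - intros x y s [Hx [Hy Hs]]; destruct (Hh x y) as [m [Hm [Hxm Hym]]].
    (* Being below [m], the supremum [s] has [rho x s + rho s y = rho x y - 2 * rho s m], so the
       triangle inequality forces equality. *)
    specialize (Hs m Hxm Hym).
    pose proof (dist_tri x s y); pose proof (dist_sym s y); pose proof (dist_sym m y).
    pose proof (dist_ge0 s m).
    unfold order_of, between in *; lra.
  - intros x y z Hy Hz; destruct (Rle_dec (rho x y) (rho x z)).
    + left; apply (horofunction_upper_cone h x); auto.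
    + right; apply (horofunction_upper_cone h x); auto; lra.
Qed.

Lemma preceq_root_usms z : usms rho (preceq_root rho z).
Proof. rewrite <- order_of_dist; apply horofunction_usms, dist_horofunction. Qed.

Lemma horofunction_root h r : (forall x, order_of rho h x r) ->
  forall x, h x = rho r x + h r.
Proof. intros H x; specialize (H x); unfold order_of in H; rewrite dist_sym; lra. Qed.

Lemma order_of_root h r : (forall x, order_of rho h x r) ->
  order_of rho h = preceq_root rho r.
Proof.
  intros H; rewrite <- order_of_dist; apply order_of_mod_const; symmetry.
  apply mod_const_eq with (h r), horofunction_root, H.
Qed.

(** Any [x] has a common upper bound with [y], which by maximality is [y]. *)
Lemma maximal_root h y : horofunction rho h ->
  (forall z, order_of rho h y z -> y = z) -> forall x, order_of rho h x y.
Proof.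
  intros Hh Hy x; destruct (Hh x y) as [m [_ [Hx Hm]]].
  rewrite (Hy _ Hm) at 1; assumption.
Qed.

Lemma preceq_root_top z x : preceq_root rho z x z.
Proof. apply between_segment; unfold between; rewrite dist_refl; lra. Qed.

(** * Rooted orders and their Hausdorff distance *)

Lemma O_plus_r_root tau : O_plus_r rho tau <-> exists z, tau = preceq_root rho z.
Proof.
  split.
  - intros [Hu [r Hr]]; destruct (usms_horofunction r _ Hu) as [h [Hh E]].
    exists r; rewrite E in *; apply order_of_root, Hr.
  - intros [z ->]; split; [apply preceq_root_usms|].
    exists z; intros x; apply preceq_root_top.
Qed.

(** The segments from [x] and [y] to [s] merge at the median [m]. Past [m] take [t' = t]; before [m]
    take [t' = m], which moves [t] by at most [rho x m]. *)
Lemma root_near x y s t : preceq_root rho x s t ->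
  exists t', preceq_root rho y s t' /\ rho t t' <= rho x y.
Proof.
  intros H; apply segment_between in H.
  destruct (median x y s) as [m [H1 [H2 H3]]].
  destruct (Rle_dec (rho x t) (rho x m)) as [L|L].
  - exists m; split; [apply between_segment; assumption|].
    pose proof (between_le _ _ _ _ H H2 L).
    pose proof (dist_ge0 m y); pose proof (dist_ge0 x t); unfold between in *; lra.
  - exists t; rewrite dist_refl; split; [|apply dist_ge0].
    apply between_segment; apply Rnot_le_lt, Rlt_le in L.
    pose proof (between_le _ _ _ _ H2 H L).
    pose proof (dist_tri y m t); pose proof (dist_tri y t s).
    unfold between in *; lra.
Qed.

Lemma root_Hd_admissible x y e : rho x y < e ->
  Hd_admissible rho (as_set (preceq_root rho x)) (as_set (preceq_root rho y)) e.
Proof.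
  intros He; pose proof (dist_ge0 x y); split; [lra|].
  split; intros [s t] Hst; unfold as_set in Hst; simpl in Hst.
  - destruct (root_near _ y _ _ Hst) as [t' [H1 H2]]; exists (s, t').
    split; [assumption|]; unfold d_plus; simpl; rewrite dist_refl; lra.
  - destruct (root_near _ x _ _ Hst) as [t' [H1 H2]]; exists (s, t').
    split; [assumption|]; unfold d_plus; simpl; rewrite dist_refl.
    rewrite (dist_sym y x) in H2; lra.
Qed.

Lemma root_Hd_admissible_inv x y e :
  Hd_admissible rho (as_set (preceq_root rho x)) (as_set (preceq_root rho y)) e -> rho x y < e.
Proof.
  intros [He [H _]].
  (* The pair [(y, x)] is extremal: a pair [(s, t)] with [t] between [y] and [s] has
     [rho y t <= rho y s], so it is at distance at least [rho x y]. *)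
  destruct (H (y, x) (preceq_root_top x y)) as [[s t] [Hst Hd]].
  apply segment_between in Hst; unfold d_plus, between in *; simpl in *.
  pose proof (dist_tri x t y); pose proof (dist_sym t y).
  pose proof (dist_ge0 t s); lra.
Qed.

Lemma rooted_isometric : rooted_orders_isometric rho.
Proof.
  exists (preceq_root rho); split; [|split].
  - intros x; apply O_plus_r_root; exists x; reflexivity.
  - intros tau H; destruct (proj1 (O_plus_r_root tau) H) as [z ->]; exists z; reflexivity.
  - intros x y; split.
    + intros e He; apply root_Hd_admissible_inv in He; lra.
    + intros b Hb; apply le_epsilon; intros e He.
      apply Hb, root_Hd_admissible; lra.
Qed.

Lemma root_Hd_lt x y e :
  Hd_lt rho (as_set (preceq_root rho x)) (as_set (preceq_root rho y)) e <-> rho x y < e.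
Proof.
  split.
  - intros [e' [He' H]]; apply root_Hd_admissible_inv in H; lra.
  - intros H; exists ((rho x y + e) / 2); split; [lra|].
    apply root_Hd_admissible; lra.
Qed.

(** * Roots and descending rays in a complete tree *)

Context (Hcomplete : complete rho).

(** Points of the upper cone of [z] whose distances from [z] approach the supremum [L] form a Cauchy
    sequence, and the limit is a maximal point. It belongs to the cone, so the bound by [d] stays
    strict. *)
Lemma horofunction_bounded_cone_root h z d : horofunction rho h ->
  (forall y, order_of rho h z y -> rho z y < d) ->
  exists r, rho z r < d /\ forall x, order_of rho h x r.
Proof.
  intros Hh Hd.
  destruct (completeness (fun t => exists y, order_of rho h z y /\ rho z y = t)) as [L [HL1 HL2]].
  { exists d; intros t [y [Hy <-]]; apply Rlt_le, Hd, Hy. }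
  { exists 0, z; split; [apply order_of_refl | apply dist_refl]. }
  assert (Hle : forall y, order_of rho h z y -> rho z y <= L).
  { intros y Hy; apply HL1; exists y; auto. }
  assert (Hex : forall n : nat, exists y, order_of rho h z y /\ L - / INR (S n) < rho z y).
  { intros n; apply NNPP; intros Hn.
    pose proof (Rinv_0_lt_compat _ (lt_0_INR (S n) ltac:(lia))).
    enough (L <= L - / INR (S n)) by lra.
    apply HL2; intros t [y [Hy <-]]; apply Rnot_lt_le; intros Hlt.
    apply Hn; exists y; auto. }
  pose (u n := proj1_sig (constructive_indefinite_description _ (Hex n))).
  assert (Hu : forall n, order_of rho h z (u n) /\ L - / INR (S n) < rho z (u n)).
  { intros n; apply (proj2_sig (constructive_indefinite_description _ (Hex n))). }
  assert (Hsmall : forall e, 0 < e -> exists N, forall n, (N <= n)%nat -> / INR (S n) < e).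
  { intros e He; destruct (archimed_cor1 e He) as [N [HN HN0]]; exists N; intros n Hn.
    apply Rle_lt_trans with (/ INR N); [|assumption].
    apply Rinv_le_contravar; [apply lt_0_INR; assumption | apply le_INR; lia]. }
  destruct (Hcomplete u) as [l Hl].
  { intros e He; destruct (Hsmall (e / 2)) as [N HN]; [lra|].
    exists N; intros m n Hm Hn.
    pose proof (HN m Hm); pose proof (HN n Hn).
    destruct (Hu m) as [Hm1 Hm2], (Hu n) as [Hn1 Hn2].
    (* The common upper bound [w] is within [L] of [z], so it is within [e / 2] of both [u m] and
       [u n]. *)
    destruct (Hh (u m) (u n)) as [w [Hw [Hw1 Hw2]]].
    pose proof (Hle _ (order_of_trans _ _ _ _ Hh Hm1 Hw1)).
    pose proof (order_of_between _ _ _ _ Hh Hm1 Hw1).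
    pose proof (order_of_between _ _ _ _ Hh Hn1 Hw2).
    pose proof (dist_sym w (u n)); unfold between in *; lra. }
  assert (Hlim : forall e, 0 < e -> L - e < h z - h l /\ L - e < rho z l).
  { intros e He; destruct (Hsmall (e / 2)) as [N1 HN1]; [lra|].
    destruct (Hl (e / 2)) as [N2 HN2]; [lra|].
    set (n := Nat.max N1 N2); pose proof (HN1 n ltac:(lia)); pose proof (HN2 n ltac:(lia)).
    destruct (Hu n) as [Hn1 Hn2]; unfold order_of in Hn1.
    pose proof (horofunction_lip _ Hh l (u n)); pose proof (dist_tri z l (u n)).
    pose proof (dist_sym l (u n)); lra. }
  assert (Hzl : L <= h z - h l).
  { apply Rnot_lt_le; intros Hlt.
    destruct (Hlim (L - (h z - h l))) as [Hc _]; [lra|]; lra. }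
  assert (Hzl' : order_of rho h z l).
  { assert (rho z l <= L).
    { apply Rnot_lt_le; intros Hlt.
      destruct (Hl (rho z l - L)) as [N HN]; [lra|]; specialize (HN N (Nat.le_refl N)).
      destruct (Hu N) as [HN1 _]; pose proof (Hle _ HN1).
      pose proof (dist_tri z (u N) l); lra. }
    pose proof (horofunction_lip _ Hh z l); unfold order_of; lra. }
  exists l; split; [apply Hd, Hzl'|].
  (* A point above [l] is at distance at most [L] from [z], a distance that [l] already attains. *)
  apply maximal_root; [assumption|]; intros y Hy.
  pose proof (Hle _ (order_of_trans _ _ _ _ Hh Hzl' Hy)).
  pose proof (order_of_between _ _ _ _ Hh Hzl' Hy).
  pose proof (dist_ge0 l y); apply dist_eq; unfold between, order_of in *; lra.
Qed.

(** If the cone reaches distance [d] or more, the segment from [z] to such a point stays in the cone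
    and contains a point at distance exactly [d]. *)
Lemma horofunction_cone_point h z d : horofunction rho h -> 0 <= d ->
  (exists r, rho z r < d /\ forall x, order_of rho h x r) \/
  (exists y, order_of rho h z y /\ rho z y = d).
Proof.
  intros Hh Hd.
  destruct (classic (exists y, order_of rho h z y /\ rho z y = d)) as [H|H]; [auto|].
  left; apply horofunction_bounded_cone_root; [assumption|].
  intros y Hy; apply Rnot_le_lt; intros Hle.
  destruct (between_exists z y d) as [w [Hw Ew]]; [lra|].
  apply H; exists w; split; [|assumption].
  apply (order_of_interval _ _ _ _ Hh Hw Hy).
Qed.

Lemma unrooted_cone_point h z d : horofunction rho h -> 0 <= d ->
  ~ (exists r, forall x, order_of rho h x r) -> exists y, order_of rho h z y /\ rho z y = d.
Proof.
  intros Hh Hd Hn; destruct (horofunction_cone_point h z d Hh Hd) as [[r [_ Hr]]|H];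
    [|assumption].
  contradiction Hn; exists r; assumption.
Qed.

(** The descent from [p] joins that of [o] at a point [m] with [rho o m <= rho o p], hence no later
    than [z]. *)
Lemma order_of_far h o p z : horofunction rho h -> order_of rho h o z ->
  rho o p <= rho o z -> order_of rho h p z.
Proof.
  intros Hh Hz Hle; destruct (Hh p o) as [m [Hm [Hp Ho]]].
  apply (order_of_trans _ _ m); [assumption..|].
  apply (horofunction_upper_cone h o); auto.
  pose proof (dist_sym p o); pose proof (dist_sym m o); pose proof (dist_ge0 p m).
  unfold between in Hm; lra.
Qed.

(** * The metric compactification consists of the classes of horofunctions *)

Lemma d_emb_mod_const o z : d_emb rho o z = mod_const (rho z).
Proof. symmetry; apply mod_const_eq with (- rho o z); intros x; lra. Qed.

Lemma compact_list_bounded (o : X) (l : list ((X -> Prop) * (R -> Prop))) :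
  (forall KU, In KU l -> compact_for (metric_open rho) (fst KU) /\ R_open (snd KU)) ->
  exists D, 0 <= D /\ forall KU, In KU l -> forall y, fst KU y -> rho o y <= D.
Proof.
  intros Hl; apply (list_bound _ (fun KU D => forall y, fst KU y -> rho o y <= D)).
  - intros KU b c H Hbc y Hy; specialize (H y Hy); lra.
  - intros KU HKU; apply compact_bounded, Hl, HKU.
Qed.

Lemma horofunction_in_compactification o h : horofunction rho h ->
  metric_compactification rho o (mod_const h).
Proof.
  intros Hh; pose proof (horofunction_continuous _ Hh) as Hc.
  split; [exists h; auto|]; intros UU [_ [_ HUU]] Hq.
  destruct (classic (exists r, forall x, order_of rho h x r)) as [[r Hr]|Hn].
  - exists r; rewrite d_emb_mod_const.
    rewrite (mod_const_eq (rho r) h (h r)); [assumption|].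
    apply horofunction_root, Hr.
  - destruct (HUU h (conj Hc Hq)) as [l [Hl1 [Hl2 Hl3]]].
    destruct (compact_list_bounded o l Hl1) as [D [HD0 HD]].
    (* All points of the compact sets in [l] are within [D] of [o], hence below [z]; there [h]
       equals [rho z + h z]. *)
    destruct (unrooted_cone_point h o D Hh HD0 Hn) as [z [Hz Ez]].
    exists z; rewrite d_emb_mod_const.
    rewrite (mod_const_eq (rho z) (fun y => rho z y + h z) (h z)) by reflexivity.
    apply Hl3.
    + apply (continuous_shift (rho z) _ (h z)); [|reflexivity].
      apply horofunction_continuous, dist_horofunction.
    + intros KU HKU y Hy.
      replace (rho z y + h z) with (h y); [apply (Hl2 _ HKU _ Hy)|].
      pose proof (order_of_far h o y z Hh Hz) as H.
      rewrite Ez in H; specialize (H (HD _ HKU _ Hy)).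
      unfold order_of in H; rewrite (dist_sym z y); lra.
Qed.

(** Prescribing values up to [e] at finitely many points is a compact-open condition, since
    singletons are compact. *)
Lemma compactification_approx o f (l : list X) e : continuous_fun rho f ->
  metric_compactification rho o (mod_const f) -> 0 < e ->
  exists z c, forall p, In p l -> Rabs (rho z p + c - f p) < e.
Proof.
  intros Hf [_ Hcl] He.
  pose (L := map (fun p => ((fun y : X => y = p), (fun r => Rabs (r - f p) < e))) l).
  destruct (Hcl (basic_open L)) as [z [g [Hg [Eg HgL]]]].
  - apply basic_open_open; unfold L; intros KU HKU; apply in_map_iff in HKU.
    destruct HKU as [p [<- Hp]]; split; [apply compact_single|]; simpl.
    intros r Hr; exists (e - Rabs (r - f p)); split; [lra|]; intros s Hs.
    replace (s - f p) with ((s - r) + (r - f p)) by ring.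
    pose proof (Rabs_triang (s - r) (r - f p)); lra.
  - exists f; split; [assumption | split; [reflexivity|]]; unfold L.
    intros KU HKU; apply in_map_iff in HKU; destruct HKU as [p [<- Hp]].
    intros x Hx; simpl in *; rewrite Hx, Rminus_diag, Rabs_R0; assumption.
  - rewrite d_emb_mod_const in Eg; destruct (mod_const_inv _ _ Eg) as [c Hc].
    exists z, c; intros p Hp; rewrite <- Hc.
    apply (HgL ((fun y : X => y = p), (fun r => Rabs (r - f p) < e))); [|reflexivity].
    apply in_map_iff; exists p; auto.
Qed.

Lemma compactification_horofunction o f : continuous_fun rho f ->
  metric_compactification rho o (mod_const f) -> horofunction rho f.
Proof.
  intros Hf Hcl.
  assert (Hlip : forall x y, f x - f y <= rho x y).
  { intros x y; apply le_epsilon; intros e He.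
    destruct (compactification_approx o f (x :: y :: nil) (e / 2) Hf Hcl) as [z [c H]]; [lra|].
    pose proof (Rabs_def2 _ _ (H x ltac:(simpl; auto))).
    pose proof (Rabs_def2 _ _ (H y ltac:(simpl; auto))).
    pose proof (dist_tri z y x); pose proof (dist_sym y x); lra. }
  intros x y.
  (* Unit descent from both ends determines the position of [m] on the segment. *)
  destruct (between_exists x y ((rho x y + (f x - f y)) / 2)) as [m [Hm Em]].
  { pose proof (Hlip x y); pose proof (Hlip y x); pose proof (dist_sym x y); lra. }
  assert (Happ : forall e, 0 < e -> rho x m <= f x - f m + e /\ rho y m <= f y - f m + e).
  { intros e He.
    destruct (compactification_approx o f (x :: y :: m :: nil) (e / 4) Hf Hcl) as [z [c H]]; [lra|].
    pose proof (Rabs_def2 _ _ (H x ltac:(simpl; auto))).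
    pose proof (Rabs_def2 _ _ (H y ltac:(simpl; auto))).
    pose proof (Rabs_def2 _ _ (H m ltac:(simpl; auto))).
    (* At the median [w] the function [rho z] has descended at unit speed from [x] and [y]; [m] is
       close to [w] because [f] is close to [rho z + c] at [x] and [y]. *)
    destruct (median x y z) as [w [W1 [W2 W3]]].
    pose proof (between_dist _ _ _ _ Hm W1) as Emw.
    assert (rho m w <= e / 4).
    { rewrite Emw; apply Rabs_le; pose proof (dist_sym x z); pose proof (dist_sym y z).
      pose proof (dist_sym w y); unfold between in *; lra. }
    pose proof (dist_tri z w m); pose proof (dist_sym x z); pose proof (dist_sym y z).
    pose proof (dist_sym z w); pose proof (dist_sym w m).
    pose proof (dist_tri x w m); pose proof (dist_tri y w m).
    unfold between in *; lra. }
  exists m; split; [assumption|].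
  pose proof (Hlip x m); pose proof (Hlip y m).
  split; apply Rle_antisym; try lra; apply le_epsilon; intros e He; apply Happ, He.
Qed.

Lemma compactification_horofunctions o q :
  metric_compactification rho o q <-> exists h, horofunction rho h /\ q = mod_const h.
Proof.
  split.
  - intros Hq; destruct (proj1 Hq) as [f [Hf ->]]; exists f; split; [|reflexivity].
    apply (compactification_horofunction o); assumption.
  - intros [h [Hh ->]]; apply horofunction_in_compactification, Hh.
Qed.

(** * Comparison of the two topologies *)

Lemma potentials_inj (o : X) tau sigma : O_plus rho tau -> O_plus rho sigma ->
  potentials rho tau = potentials rho sigma -> tau = sigma.
Proof.
  intros Ht Hs E.
  destruct (usms_horofunction o _ Ht) as [h [Hh ->]], (usms_horofunction o _ Hs) as [k [Hk ->]].
  rewrite !(potentials_order_of o) in E by assumption; apply order_of_mod_const, E.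
Qed.

(** If the descents of [p] and [y'] met before [y], then [y'] would descend through [y], contrary to
    [y] lying strictly below [y']. So the descent of [p] passes through [y]. *)
Lemma order_of_beyond k p y y' : horofunction rho k -> between rho p y y' -> y <> y' ->
  order_of rho k y y' -> order_of rho k p y.
Proof.
  intros Hk B Hne Hy; destruct (Hk p y') as [m [Bm [Hpm Hym]]].
  destruct (Rle_dec (rho p y) (rho p m)) as [L|L].
  - apply (order_of_interval k p y m Hk); [|assumption].
    apply (between_le p y'); assumption.
  - exfalso; apply Rnot_le_lt, Rlt_le in L.
    pose proof (between_le _ _ _ _ Bm B L) as B'.
    pose proof (dist_pos _ _ Hne).
    destruct (order_of_interval k y' y m Hk) as [H1 _]; [|assumption|].
    + pose proof (dist_sym y' y); pose proof (dist_sym y m); pose proof (dist_sym y' m).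
      unfold between in *; lra.
    + unfold order_of in *; pose proof (dist_sym y' y); lra.
Qed.

Lemma open_separates_U_xy (o : X) x y tau : U_xy rho x y tau ->
  exists V, Cquot_open rho V /\ V (potentials rho tau) /\
    forall sigma, O_plus rho sigma -> V (potentials rho sigma) -> U_xy rho x y sigma.
Proof.
  intros [Htau [Hxy Hne]].
  destruct (usms_horofunction o _ Htau) as [h [Hh ->]].
  (* Since the order is not the one rooted at [y], the point [y] is not maximal. *)
  assert (Hy' : exists y', order_of rho h y y' /\ y <> y').
  { apply NNPP; intros Hn; apply Hne, order_of_root, maximal_root; [assumption|].
    intros z Hz; apply NNPP; intros Hyz; apply Hn; exists z; auto. }
  destruct Hy' as [y' [Hy' Hyy']]; pose proof (dist_pos _ _ Hyy') as Hpos.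
  set (e := rho y y') in *.
  (* These bounds make the drop of [k] from [x] to [y'] exceed [rho x y' - e = rho x y], so the
     point where [x] and [y'] meet lies strictly beyond [y]. *)
  pose (l := ((fun p => p = x), (fun r => h x - e / 2 < r)) ::
             ((fun p => p = y'), (fun r => r < h y' + e / 2)) :: nil).
  exists (basic_open l); split; [|split].
  - apply basic_open_open; intros KU [<-|[<-|[]]]; split; try apply compact_single;
      simpl; intros r Hr.
    + exists (r - (h x - e / 2)); split; [lra|]; intros s Hs; apply Rabs_def2 in Hs; lra.
    + exists (h y' + e / 2 - r); split; [lra|]; intros s Hs; apply Rabs_def2 in Hs; lra.
  - exists h; split; [apply horofunction_continuous; assumption|].
    split; [apply potentials_order_of; assumption|].
    intros KU [<-|[<-|[]]] p Hp; simpl in *; subst p; lra.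
  - intros sigma Hs [g [Hg [Eg Hgl]]].
    destruct (usms_horofunction o _ Hs) as [k [Hk ->]].
    rewrite (potentials_order_of o) in Eg by assumption.
    destruct (mod_const_inv _ _ Eg) as [c Hc].
    assert (Hx : h x - e / 2 < k x + c)
      by (rewrite <- Hc; apply (Hgl _ (or_introl eq_refl)); reflexivity).
    assert (Hy : k y' + c < h y' + e / 2)
      by (rewrite <- Hc; apply (Hgl _ (or_intror (or_introl eq_refl))); reflexivity).
    pose proof (order_of_between _ _ _ _ Hh Hxy Hy') as B.
    destruct (Hk x y') as [m [Bm [Hxm Hym]]].
    assert (Lt : rho x y < rho x m).
    { pose proof (dist_sym m y'); unfold order_of, between in *; fold e in B, Hy'; lra. }
    assert (Bxm : between rho x y m) by (apply (between_le x y'); auto; lra).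
    destruct (order_of_interval _ _ _ _ Hk Bxm Hxm) as [H1 H2].
    split; [assumption | split; [assumption|]]; intros E.
    assert (H3 : order_of rho k m y) by (rewrite E; apply preceq_root_top).
    pose proof (order_of_antisym _ _ _ H2 H3); subst m; lra.
Qed.

Context (Hlc : locally_compact rho).

(* A horofunction that is larger on a small sphere around [z] than at [z] cannot
   decrease through that sphere, so it has a root inside. *)
Lemma open_separates_root (o z : X) e : 0 < e ->
  exists V, Cquot_open rho V /\ V (potentials rho (preceq_root rho z)) /\
    forall sigma, O_plus rho sigma -> V (potentials rho sigma) ->
      exists w, rho z w < e /\ sigma = preceq_root rho w.
Proof.
  intros He; destruct (Hlc z) as [K [HK [d [Hd HdK]]]].
  (* Here [r < d] keeps the sphere inside [K], and [r < e] bounds the distance to the root. *)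
  pose (r := Rmin d e / 2).
  assert (Hr : 0 < r /\ r < d /\ r < e).
  { pose proof (Rmin_l d e); pose proof (Rmin_r d e); pose proof (Rmin_glb_lt d e 0 Hd He).
    unfold r; lra. }
  (* The value [r / 2] separates the values [0] and [r] of [rho z] at [z] and on the sphere. *)
  pose (l := ((fun p => p = z), (fun t => t < r / 2)) ::
             ((fun p => rho z p = r), (fun t => r / 2 < t)) :: nil).
  exists (basic_open l); split; [|split].
  - apply basic_open_open; intros KU [<-|[<-|[]]]; simpl; split.
    + apply compact_single.
    + intros t Ht; exists (r / 2 - t); split; [lra|]; intros s Hs; apply Rabs_def2 in Hs; lra.
    + apply (compact_sphere K); [assumption|]; intros y Hy; apply HdK; lra.
    + intros t Ht; exists (t - r / 2); split; [lra|]; intros s Hs; apply Rabs_def2 in Hs; lra.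
  - exists (rho z); split; [apply horofunction_continuous, dist_horofunction|].
    split; [rewrite <- order_of_dist; apply (potentials_order_of z), dist_horofunction|].
    intros KU [<-|[<-|[]]] p Hp; simpl in *; [subst p; rewrite dist_refl|]; lra.
  - intros sigma Hs [g [Hg [Eg Hgl]]].
    destruct (usms_horofunction o _ Hs) as [k [Hk ->]].
    rewrite (potentials_order_of o) in Eg by assumption.
    destruct (mod_const_inv _ _ Eg) as [c Hc].
    destruct (horofunction_cone_point k z r Hk) as [[w [Hw1 Hw2]]|[y [Hy Ey]]]; [lra| |].
    + exists w; split; [lra|]; apply order_of_root, Hw2.
    + exfalso.
      assert (k z + c < r / 2)
        by (rewrite <- Hc; apply (Hgl _ (or_introl eq_refl)); reflexivity).
      assert (r / 2 < k y + c)
        by (rewrite <- Hc; apply (Hgl _ (or_intror (or_introl eq_refl))); assumption).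
      unfold order_of in Hy; lra.
Qed.

Lemma O_plus_open_image (o : X) U : O_plus_open rho U ->
  mc_open rho o (fun q => exists tau, U tau /\ potentials rho tau = q).
Proof.
  intros [HU1 HU2].
  (* The union of all open sets that meet the image of [O_plus] only inside the image of [U]. *)
  exists (fun q => exists V, (Cquot_open rho V /\
            forall sigma, O_plus rho sigma -> V (potentials rho sigma) -> U sigma) /\ V q).
  split; [apply Cquot_open_union; intros V [HV _]; assumption|].
  intros q; split.
  - intros [tau [Htau <-]]; pose proof (HU1 _ Htau) as HO; split.
    + destruct (usms_horofunction o _ HO) as [h [Hh ->]].
      apply compactification_horofunctions; exists h; split; [assumption|].
      apply potentials_order_of; assumption.
    + destruct (HU2 _ Htau) as [B [[[HB1 HB2]|[x [y [_ ->]]]] [HBt HBU]]].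
      * destruct (proj1 (O_plus_r_root tau) (HB1 _ HBt)) as [z Ez]; subst tau.
        destruct (HB2 _ HBt) as [e [He HBe]].
        destruct (open_separates_root o z e He) as [V [HV1 [HV2 HV3]]].
        exists V; split; [split; [assumption|]|assumption].
        intros sigma Hs HVs; destruct (HV3 _ Hs HVs) as [w [Hw ->]].
        apply HBU, HBe; [apply O_plus_r_root; exists w; reflexivity|].
        apply root_Hd_lt, Hw.
      * destruct (open_separates_U_xy o x y tau HBt) as [V [HV1 [HV2 HV3]]].
        exists V; split; [split; [assumption|]|assumption].
        intros sigma Hs HVs; apply HBU, HV3; assumption.
  - intros [Hq [V [[HV1 HV2] HVq]]].
    destruct (proj1 (compactification_horofunctions o q) Hq) as [h [Hh ->]].
    exists (order_of rho h).
    assert (E : potentials rho (order_of rho h) = mod_const h)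
      by (apply potentials_order_of; assumption).
    split; [|assumption].
    apply HV2; [apply horofunction_usms, Hh | rewrite E; assumption].
Qed.

Lemma image_open_O_plus (o : X) U : (forall tau, U tau -> O_plus rho tau) ->
  mc_open rho o (fun q => exists tau, U tau /\ potentials rho tau = q) -> O_plus_open rho U.
Proof.
  intros HU [UU [[_ [_ HUU]] Himg]]; split; [assumption|].
  assert (Hin : forall h, horofunction rho h -> (UU (mod_const h) <-> U (order_of rho h))).
  { intros h Hh; pose proof (potentials_order_of o h Hh) as E; split; intros H.
    - destruct (proj2 (Himg (mod_const h))) as [tau [Ht Et]].
      { split; [|assumption]; apply horofunction_in_compactification, Hh. }
      rewrite (potentials_inj o (order_of rho h) tau); auto; [|congruence].
      apply horofunction_usms, Hh.
    - apply Himg; exists (order_of rho h); auto. }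
  assert (Hnbhd : forall h, horofunction rho h -> U (order_of rho h) ->
    exists l, (forall KU, In KU l -> compact_for (metric_open rho) (fst KU) /\ R_open (snd KU)) /\
     (forall KU, In KU l -> co_subbasic (fst KU) (snd KU) h) /\
     (forall k c, horofunction rho k ->
        (forall KU, In KU l -> co_subbasic (fst KU) (snd KU) (fun x => k x + c)) ->
        U (order_of rho k))).
  { intros h Hh H; apply Hin in H; [|assumption].
    destruct (HUU h) as [l [H1 [H2 H3]]].
    { split; [apply horofunction_continuous|]; assumption. }
    exists l; split; [assumption | split; [assumption|]]; intros k c Hk Hkl.
    apply Hin; [assumption|].
    rewrite (mod_const_eq k (fun x => k x + c) c) by reflexivity.
    apply H3; [|assumption].
    apply (continuous_shift k _ c); [apply horofunction_continuous, Hk | reflexivity]. }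
  intros tau Htau.
  destruct (usms_horofunction o _ (HU _ Htau)) as [h [Hh Eh]].
  destruct (classic (exists r, forall x, order_of rho h x r)) as [[r Hr]|Hn].
  - exists (fun sigma => O_plus_r rho sigma /\ U sigma); split; [left; split|split].
    + intros sigma [H _]; assumption.
    + intros sigma [Hs HUs]; destruct (proj1 (O_plus_r_root sigma) Hs) as [z ->].
      pose proof (dist_horofunction z) as Hz.
      destruct (Hnbhd (rho z) Hz) as [l [H1 [H2 H3]]]; [rewrite order_of_dist; assumption|].
      (* Moving the root from [z] to [w] changes the distance function by at most [rho z w], so one
         margin [e] serves all constraints. *)
      destruct (list_small _ (fun KU e => forall g,
        (forall y, Rabs (g y - rho z y) < e) -> co_subbasic (fst KU) (snd KU) g) l)
        as [e [He Hel]].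
      * intros KU b c H Hcb g Hg; apply H; intros y; specialize (Hg y); lra.
      * intros KU HKU; destruct (H1 _ HKU).
        apply compact_margin; auto; apply horofunction_continuous, Hz.
      * exists e; split; [assumption|]; intros sigma' Hs' Hd.
        destruct (proj1 (O_plus_r_root sigma') Hs') as [w ->]; split; [assumption|].
        apply root_Hd_lt in Hd; rewrite <- order_of_dist.
        apply (H3 _ 0); [apply dist_horofunction|]; intros KU HKU.
        apply (Hel _ HKU); intros y.
        pose proof (dist_tri w z y); pose proof (dist_tri z w y); pose proof (dist_sym w z).
        apply Rabs_def1; lra.
    + split; [|assumption]; apply O_plus_r_root; exists r.
      rewrite Eh; apply order_of_root, Hr.
    + intros s [_ Hs]; assumption.
  - rewrite Eh in *; destruct (Hnbhd h Hh Htau) as [l [H1 [H2 H3]]].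
    destruct (compact_list_bounded o l H1) as [D [HD0 HD]].
    (* All compact sets in [l] lie below [y]. The point [y'], one unit further up, gives a strict
       relation that fixes horofunctions on these sets up to a constant. *)
    destruct (unrooted_cone_point h o D Hh HD0 Hn) as [y [Hy Ey]].
    destruct (unrooted_cone_point h y 1 Hh ltac:(lra) Hn) as [y' [Hy' Ey']].
    assert (Hne : y <> y') by (intros ->; rewrite dist_refl in Ey'; lra).
    exists (U_xy rho y y'); split; [right; exists y, y'; auto|split].
    + split; [apply horofunction_usms, Hh | split; [assumption|]]; intros E.
      apply Hn; exists y'; intros x; rewrite E; apply preceq_root_top.
    + intros sigma [Hs [Hsy _]].
      destruct (usms_horofunction o _ Hs) as [k [Hk ->]].
      (* The constant makes [k] agree with [h] at [y], hence at every [p] that both orders place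
         below [y]. *)
      apply (H3 k (h y - k y) Hk); intros KU HKU p Hp.
      assert (Hpy : order_of rho h p y).
      { apply (order_of_far h o); auto; rewrite Ey; apply (HD _ HKU _ Hp). }
      pose proof (order_of_between _ _ _ _ Hh Hpy Hy') as B.
      pose proof (order_of_beyond k p y y' Hk B Hne Hsy).
      replace (k p + (h y - k y)) with (h p); [apply (H2 _ HKU _ Hp)|].
      unfold order_of in *; lra.
Qed.

End RTree.

Theorem theorem2 (X : Type) (rho : X -> X -> R)
  (Htree : is_R_tree rho) (Hcomplete : complete rho) (Hlc : locally_compact rho) :
  rooted_orders_isometric rho /\
  forall o : X,
    homeomorphic (O_plus rho) (O_plus_open rho)
                 (metric_compactification rho o) (mc_open rho o).
Proof.
  destruct Htree as [Hmet [Hgeo [Huniq Htri]]].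
  split; [apply rooted_isometric; assumption|].
  intros o; exists (potentials rho); split; [|split; [|split]].
  - intros tau Ht; destruct (usms_horofunction _ Hmet o _ Ht) as [h [Hh ->]].
    rewrite (potentials_order_of _ o) by assumption.
    apply horofunction_in_compactification; assumption.
  - intros tau sigma; apply potentials_inj; assumption.
  - intros q Hq.
    apply compactification_horofunctions in Hq; [|assumption..].
    destruct Hq as [h [Hh ->]]; exists (order_of rho h); split.
    + apply horofunction_usms; assumption.
    + apply potentials_order_of; assumption.
  - intros U HU; split.
    + apply O_plus_open_image; assumption.
    + apply image_open_O_plus; assumption.
Qed.
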